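(* For every integer $r\ge 0$ and every $x\in\mathbb{C}$ with $|x|<1$, $$\sum_{n=1}^{\infty}\binom{n+r}{n}\zeta(n+1)x^{n}=\sum_{m=1}^{r}\binom{r}{m}\zeta(m+1,1-x)\,x^{m}-\psi(1-x)-\gamma.$$
   Context: The Hurwitz zeta function is $\zeta(s,a)=\sum_{k=0}^{\infty}\frac{1}{(k+a)^{s}}$ for $\mathrm{Re}\,a>0$, $\mathrm{Re}\,s>1$, and $\zeta(s)=\zeta(s,1)$ is the Riemann zeta function. $\psi=\Gamma'/\Gamma$ is the digamma function and $\gamma$ is Euler's constant. An empty sum is $0$. *)

(* Defs.v *)
From Stdlib Require Import Reals Factorial.
From Coquelicot Require Import Coquelicot.
Open Scope C_scope.

(* The operators below are total: they carry the usual value wherever the limit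
   or the series converges, and an unspecified value elsewhere. *)

Definition CLim_seq (u : nat -> C) : C :=
  (real (Lim_seq (fun n => Re (u n))), real (Lim_seq (fun n => Im (u n)))).

Definition CSeries (a : nat -> C) : C := CLim_seq (sum_n a).

Definition Cexp (z : C) : C :=
  ((exp (Re z) * cos (Im z))%R, (exp (Re z) * sin (Im z))%R).

(* Principal argument, in (-PI, PI]; unspecified at 0. *)
Definition Carg (z : C) : R :=
  if Rle_dec 0 (Im z) then acos (Re z / Cmod z) else (- acos (Re z / Cmod z))%R.

Definition Clog (z : C) : C := (ln (Cmod z), Carg z).

(* Principal branch of z^s, for z <> 0. *)
Definition Ccpow (z s : C) : C := Cexp (s * Clog z).

(* Meaningful for Re a > 0 and Re s > 1. *)
Definition hurwitz_zeta (s a : C) : C :=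
  CSeries (fun k => 1 / Ccpow (INR k + a) s).

Definition riemann_zeta (s : C) : C := hurwitz_zeta s 1.

(* z (z + 1) ... (z + n - 1) *)
Fixpoint rising (z : C) (n : nat) : C :=
  match n with
  | O => 1
  | S m => rising z m * (z + INR m)
  end.

(* Euler's definition, valid for every complex z other than 0, -1, -2, ...:
   Gamma(z) = lim n! n^z / (z (z + 1) ... (z + n)). *)
Definition CGamma (z : C) : C :=
  CLim_seq (fun n => INR (fact n) * Ccpow (INR n) z / rising z (S n)).

(* C_derive is the total complex derivative: its value is Gamma'(z) as soon as
   Gamma is complex differentiable at z (is_C_derive_unique). *)
Definition digamma (z : C) : C := C_derive CGamma z / CGamma z.

Definition euler_gamma : R :=
  real (Lim_seq (fun n => (sum_n_m (fun k => / INR k) 1 n - ln (INR n))%R)).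

(* Main.v *)
Require Import Defs.
From Stdlib Require Import Reals Factorial Lra Lia.
From Coquelicot Require Import Coquelicot.
Open Scope C_scope.

(** Everything rests on the expansion of log Gamma at 1,
      log Gamma(1 - w) = gamma w + sum_(j >= 1) zeta(j + 1) w^(j+1) / (j + 1)   for |w| < 1.
    Since 1 - y = exp (- sum_j y^(j+1) / (j + 1)), the N-th term of Euler's limit is
    N / (N + 1) times the exponential of a primitive of a power series whose coefficients
    are partial sums of zeta values, the first of them a harmonic number minus ln N
    [Gamma_seq_eq]. These coefficients are bounded by 2 uniformly in N >= 1, so dominated
    convergence for series [tannery] lets N tend to infinity coefficient by coefficient
    [CGamma_eq].
    Differentiating term by term yields the Taylor series of the digamma function
    [digamma_eq], which is the case r = 0 of the theorem [Csum_zeta_digamma].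

    For general r it remains to sum the series with binom(n+r, n) - 1 in place of
    binom(n+r, n). Write each zeta value as a sum over k >= 1. For fixed k and y = x / k,
    the sum over n of binom(n+r, n) y^n is (1 - y)^-(r+1) [Csum_neg_binom]. On the other
    side, k / (k - x) = 1 + x / (k - x); the r-th power of this, divided by k - x, is the
    sum of the terms binom(r, m) x^m / (k - x)^(m+1) of the Hurwitz zeta values, and the
    term m = 0 is the one that the - 1 removes [Csum_hurwitz_term]. The
    sums over n and k are exchanged by [tannery] once more [Csum_neg_binom_zeta]. *)

(** * Limits and series of complex numbers *)

Definition Clim {T : Type} (F : (T -> Prop) -> Prop) (f : T -> C) (l : C) : Prop :=
  filterlim f F (locally (l : C_NormedModule)).

Definition Csum (a : nat -> C) (l : C) : Prop :=
  is_series (K := C_AbsRing) (V := C_NormedModule) a l.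

Lemma Clim_iff {T : Type} (F : (T -> Prop) -> Prop) {FF : Filter F} (f : T -> C) (l : C) :
  Clim F f l <-> forall eps : R, (0 < eps)%R -> F (fun i => (Cmod (f i - l) < eps)%R).
Proof.
  unfold Clim.
  rewrite (filterlim_locally_ball_norm (K := C_AbsRing) (U := C_NormedModule)).
  split; intros H.
  - intros eps Heps. exact (H (mkposreal eps Heps)).
  - intros eps. exact (H eps (cond_pos eps)).
Qed.

(** A function of a complex variable has its differential taken along the neighbourhoods
    of the normed ring of complex numbers, whose balls are round; those of the space where
    limits take their values are square. *)
Local Notation near z := (@locally (AbsRing_UniformSpace C_AbsRing) z).

Lemma near_iff (z : C) (P : C -> Prop) :
  near z P <->
  exists d : R, (0 < d)%R /\ forall w : C, (Cmod (w - z) < d)%R -> P w.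
Proof.
  split.
  - intros [d Hd]. exists d. split; [apply cond_pos | exact Hd].
  - intros [d [Hd0 Hd]]. exists (mkposreal d Hd0). exact Hd.
Qed.

Lemma Clim_const {T : Type} (F : (T -> Prop) -> Prop) {FF : ProperFilter F}
  (c : C) : Clim F (fun _ => c) c.
Proof. apply filterlim_const. Qed.

Lemma Clim_ext_loc {T : Type} (F : (T -> Prop) -> Prop) {FF : ProperFilter F}
  (f g : T -> C) (l : C) :
  F (fun i => f i = g i) -> Clim F f l -> Clim F g l.
Proof. apply filterlim_ext_loc. Qed.

Lemma Clim_ext {T : Type} (F : (T -> Prop) -> Prop) {FF : ProperFilter F}
  (f g : T -> C) (l : C) :
  (forall i, f i = g i) -> Clim F f l -> Clim F g l.
Proof. apply filterlim_ext. Qed.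

Lemma Clim_plus {T : Type} (F : (T -> Prop) -> Prop) {FF : ProperFilter F}
  (f g : T -> C) (k l : C) :
  Clim F f k -> Clim F g l -> Clim F (fun i => f i + g i) (k + l).
Proof.
  intros Hf Hg.
  exact (filterlim_comp_2 f g Cplus Hf Hg (filterlim_plus (V := C_NormedModule) k l)).
Qed.

Lemma Clim_mult {T : Type} (F : (T -> Prop) -> Prop) {FF : ProperFilter F}
  (f g : T -> C) (k l : C) :
  Clim F f k -> Clim F g l -> Clim F (fun i => f i * g i) (k * l).
Proof.
  intros Hf Hg.
  refine (filterlim_comp_2 f g Cmult _ Hg (filterlim_scal (V := C_NormedModule) k l)).
  intros P HP. apply Hf. now apply locally_C.
Qed.

Lemma Clim_scal {T : Type} (F : (T -> Prop) -> Prop) {FF : ProperFilter F}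
  (c : C) (f : T -> C) (l : C) :
  Clim F f l -> Clim F (fun i => c * f i) (c * l).
Proof. intros Hf. apply Clim_mult; [exact FF | apply Clim_const, FF | exact Hf]. Qed.

Lemma Clim_unique {T : Type} (F : (T -> Prop) -> Prop) {FF : ProperFilter F}
  (f : T -> C) (k l : C) : Clim F f k -> Clim F f l -> k = l.
Proof. apply filterlim_locally_unique. Qed.

Lemma Clim_sum_n_m {T : Type} (F : (T -> Prop) -> Prop) {FF : ProperFilter F}
  (f : nat -> T -> C) (l : nat -> C) (p q : nat) :
  (forall m, (p <= m <= q)%nat -> Clim F (f m) (l m)) ->
  Clim F (fun i => sum_n_m (fun m => f m i) p q) (sum_n_m l p q).
Proof.
  induction q as [|q IH]; intros H.
  - destruct p as [|p].
    + apply (Clim_ext F) with (f 0%nat).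
      * intros i. now rewrite sum_n_n.
      * rewrite sum_n_n. apply H. lia.
    + apply (Clim_ext F) with (fun _ => zero).
      * intros i. rewrite sum_n_m_zero; [easy | lia].
      * rewrite sum_n_m_zero by lia. apply Clim_const, FF.
  - destruct (Nat.le_gt_cases p (S q)) as [Hp|Hp].
    + apply (Clim_ext F) with (fun i => sum_n_m (fun m => f m i) p q + f (S q) i).
      * intros i. now rewrite sum_n_Sm.
      * rewrite sum_n_Sm by easy. apply Clim_plus; [exact FF | |].
        -- apply IH. intros m Hm. apply H. lia.
        -- apply H. lia.
    + apply (Clim_ext F) with (fun _ => zero).
      * intros i. rewrite sum_n_m_zero; [easy | lia].
      * rewrite sum_n_m_zero by lia. apply Clim_const, FF.
Qed.

Lemma CLim_seq_unique (u : nat -> C) (l : C) : Clim eventually u l -> CLim_seq u = l.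
Proof.
  intros H. rewrite Clim_iff in H by apply eventually_filter.
  assert (Hre : is_lim_seq (fun n => Re (u n)) (Re l)).
  { apply is_lim_seq_spec. intros eps. generalize (H eps (cond_pos eps)).
    apply filter_imp. intros n Hn. apply Rle_lt_trans with (2 := Hn).
    apply (re_le_Cmod (u n - l)). }
  assert (Him : is_lim_seq (fun n => Im (u n)) (Im l)).
  { apply is_lim_seq_spec. intros eps. generalize (H eps (cond_pos eps)).
    apply filter_imp. intros n Hn. apply Rle_lt_trans with (2 := Hn).
    apply Rle_trans with (2 := Rmax_Cmod (u n - l)). apply Rmax_r. }
  unfold CLim_seq. rewrite (is_lim_seq_unique _ _ Hre), (is_lim_seq_unique _ _ Him).
  now destruct l.
Qed.

Lemma CSeries_unique (a : nat -> C) (l : C) : Csum a l -> CSeries a = l.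
Proof. apply CLim_seq_unique. Qed.

Lemma Csum_CSeries (a : nat -> C) (M : nat -> R) :
  (forall n, (Cmod (a n) <= M n)%R) -> ex_series M -> Csum a (CSeries a).
Proof.
  intros Ha HM.
  destruct (ex_series_le (K := C_AbsRing) (V := C_CompleteNormedModule) a M Ha HM)
    as [l Hl].
  now rewrite (CSeries_unique a l Hl).
Qed.

Lemma Csum_ext (a b : nat -> C) (l : C) : (forall n, a n = b n) -> Csum a l -> Csum b l.
Proof. apply is_series_ext. Qed.

Lemma Csum_plus (a b : nat -> C) (k l : C) :
  Csum a k -> Csum b l -> Csum (fun n => a n + b n) (k + l).
Proof. apply (is_series_plus (V := C_NormedModule)). Qed.

Lemma Csum_scal (c : C) (a : nat -> C) (l : C) :
  Csum a l -> Csum (fun n => c * a n) (c * l).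
Proof. apply (is_series_scal (V := C_NormedModule)). Qed.

Lemma Csum_sum_n_m (a : nat -> nat -> C) (l : nat -> C) (p q : nat) :
  (forall m, (p <= m <= q)%nat -> Csum (a m) (l m)) ->
  Csum (fun j => sum_n_m (fun m => a m j) p q) (sum_n_m l p q).
Proof.
  intros H.
  apply (Clim_ext eventually)
    with (fun N => sum_n_m (fun m => sum_n (a m) N) p q).
  - intros N. induction N as [|N IH].
    + rewrite sum_O. apply sum_n_m_ext. intros m. now rewrite sum_O.
    + rewrite sum_Sn, <- IH, <- sum_n_m_plus.
      apply sum_n_m_ext. intros m. now rewrite sum_Sn.
  - apply (Clim_sum_n_m eventually (fun m N => sum_n (a m) N) l p q H).
Qed.

Lemma Csum_incr (a : nat -> C) (l : C) : Csum a (l + a 0%nat) -> Csum (fun n => a (S n)) l.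
Proof. apply (is_series_incr_1 (V := C_NormedModule)). Qed.

Lemma Csum_decr (a : nat -> C) (l : C) : Csum (fun n => a (S n)) (l - a 0%nat) -> Csum a l.
Proof. apply (is_series_decr_1 (V := C_NormedModule)). Qed.

Lemma Cmod_sum_n_m_le (a : nat -> C) (M : nat -> R) (p q : nat) :
  (forall n, (Cmod (a n) <= M n)%R) -> (Cmod (sum_n_m a p q) <= sum_n_m M p q)%R.
Proof.
  intros H.
  apply Rle_trans with (1 := norm_sum_n_m (K := C_AbsRing) (V := C_NormedModule) a p q).
  apply sum_n_m_le. exact H.
Qed.

Lemma Csum_tail_le (a : nat -> C) (M : nat -> R) (l : C) (L : R) (N : nat) :
  (forall n, (Cmod (a n) <= M n)%R) -> Csum a l -> is_series M L ->
  (Cmod (l - sum_n a N) <= L - sum_n M N)%R.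
Proof.
  intros Ha Hl HL.
  assert (H1 : is_lim_seq (fun n => (sum_n M n - sum_n M N)%R) (L - sum_n M N)%R).
  { apply (is_lim_seq_minus' _ _ L (sum_n M N)); [exact HL | apply is_lim_seq_const]. }
  assert (H2 : is_lim_seq (fun n => Cmod (sum_n a n - sum_n a N)) (Cmod (l - sum_n a N))).
  { assert (Clim eventually (fun n => sum_n a n - sum_n a N) (l - sum_n a N)).
    { apply Clim_plus; [apply eventually_filter | exact Hl |].
      apply Clim_const, eventually_filter. }
    exact (filterlim_comp _ _ _ _ _ _ _ _ H (filterlim_norm (V := C_NormedModule) _)). }
  apply (is_lim_seq_le_loc _ _ _ _) with (2 := H2) (3 := H1).
  exists N. intros n Hn.
  replace (sum_n a n - sum_n a N) with (sum_n_m a (S N) n)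
    by exact (sum_n_m_sum_n (G := C_AbelianGroup) a N n Hn).
  replace (sum_n M n - sum_n M N)%R with (sum_n_m M (S N) n)
    by exact (sum_n_m_sum_n (G := R_AbelianGroup) M N n Hn).
  now apply Cmod_sum_n_m_le.
Qed.

(** Tannery's theorem, that is, dominated convergence for series: the majorant makes the
    tails uniformly small, and the finitely many remaining terms converge one by one. The
    filter is arbitrary because the parameter is an index tending to infinity in some uses
    and a complex number tending to a point in others. *)
Lemma tannery {T : Type} (F : (T -> Prop) -> Prop) {FF : ProperFilter F}
  (a : T -> nat -> C) (s : T -> C) (l : nat -> C) (M : nat -> R) :
  ex_series M ->
  F (fun i => (forall n, (Cmod (a i n) <= M n)%R) /\ Csum (a i) (s i)) ->
  (forall n, Clim F (fun i => a i n) (l n)) ->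
  Csum l (CSeries l) /\ Clim F s (CSeries l).
Proof.
  intros [L HL] Ha Hl.
  assert (HlM : forall n, (Cmod (l n) <= M n)%R).
  { intros n. apply Rnot_lt_le. intros Hlt.
    assert (Hl' := Hl n). rewrite Clim_iff in Hl' by apply FF.
    assert (Hpos : (0 < Cmod (l n) - M n)%R) by lra.
    destruct (filter_ex _ (filter_and _ _ Ha (Hl' _ Hpos))) as [i [[Hi _] Hi']].
    specialize (Hi n).
    assert (Cmod (l n) <= Cmod (a i n) + Cmod (a i n - l n))%R; [|lra].
    rewrite <- (Cmod_opp (a i n - l n)).
    replace (l n) with (a i n + - (a i n - l n)) at 1 by ring. apply Cmod_triangle. }
  assert (Hs : Csum l (CSeries l)) by (apply Csum_CSeries with M; [easy | now exists L]).
  split; [exact Hs|].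
  apply Clim_iff; [apply FF|]. intros eps Heps.
  assert (HN : exists N, (L - sum_n M N < eps / 3)%R).
  { assert (H : is_lim_seq (sum_n M) L) by exact HL. apply is_lim_seq_spec in H.
    assert (He : (0 < eps / 3)%R) by lra.
    destruct (H (mkposreal _ He)) as [N HN]. exists N.
    specialize (HN N (Nat.le_refl N)). simpl in HN.
    apply Rabs_def2 in HN. lra. }
  destruct HN as [N HN].
  assert (Hfin : Clim F (fun i => sum_n (a i) N) (sum_n l N)).
  { apply (Clim_sum_n_m F (fun n i => a i n) l 0 N). intros n _. apply Hl. }
  rewrite Clim_iff in Hfin by apply FF.
  assert (He : (0 < eps / 3)%R) by lra.
  generalize (filter_and _ _ Ha (Hfin _ He)). apply filter_imp.
  intros i [[Hi1 Hi2] Hi3].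
  assert (T1 := Csum_tail_le _ _ _ _ N Hi1 Hi2 HL).
  assert (T2 := Csum_tail_le _ _ _ _ N HlM Hs HL).
  replace (s i - CSeries l) with
    ((s i - sum_n (a i) N) + (sum_n (a i) N - sum_n l N) + - (CSeries l - sum_n l N)) by ring.
  apply Rle_lt_trans with (1 := Cmod_triangle _ _). rewrite Cmod_opp.
  assert (T3 := Cmod_triangle (s i - sum_n (a i) N) (sum_n (a i) N - sum_n l N)).
  lra.
Qed.

(** * Derivatives and power series *)

Lemma filter_C (z : C) : ProperFilter (near z).
Proof. apply locally_filter. Qed.

(** Caratheodory's form of differentiability. No division by w - z occurs, so the quotient
    q may be a series that is summed at w = z as well. *)
Lemma is_derive_caratheodory (f q : C -> C) (z l : C) :
  near z (fun w => f w - f z = (w - z) * q w) ->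
  Clim (near z) q l ->
  is_derive (K := C_AbsRing) (V := C_NormedModule) f z l.
Proof.
  intros Hf Hq. split; [apply is_linear_scal_l|].
  intros x Hx.
  apply (is_filter_lim_locally_unique (V := AbsRing_NormedModule C_AbsRing)) in Hx. subst x.
  intros eps. rewrite Clim_iff in Hq by apply filter_C.
  generalize (filter_and _ _ Hf (Hq eps (cond_pos eps))). apply filter_imp.
  intros w [E Hw].
  change (Cmod (f w - f z - (w - z) * l) <= eps * Cmod (w - z))%R.
  rewrite E. replace ((w - z) * q w - (w - z) * l) with ((q w - l) * (w - z)) by ring.
  rewrite Cmod_mult. apply Rmult_le_compat_r; [apply Cmod_ge_0 | lra].
Qed.

(** Along the segment from 0 to y, F is a function of one real variable with derivative
    zero, to which the mean value inequality applies. *)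
Lemma constant_of_is_derive_0 (F : C -> C) :
  (forall w, (Cmod w < 1)%R -> is_derive (K := C_AbsRing) (V := C_NormedModule) F w (RtoC 0)) ->
  forall y, (Cmod y < 1)%R -> F y = F 0.
Proof.
  intros HF y Hy.
  assert (E : F (RtoC 0 * y)%C = F (RtoC 1 * y)%C).
  { apply (eq_is_derive (V := C_R_NormedModule) (fun t => F (RtoC t * y)%C) 0 1); [|lra].
    intros t Ht. split; [apply is_linear_scal_l|].
    intros u Hu.
    apply (is_filter_lim_locally_unique (V := AbsRing_NormedModule R_AbsRing)) in Hu. subst u.
    intros eps.
    assert (Hty : (Cmod (RtoC t * y) < 1)%R).
    { rewrite Cmod_mult, Cmod_R, Rabs_pos_eq by lra.
      assert (H := Cmod_ge_0 y). nra. }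
    destruct (HF _ Hty) as [_ Hd].
    specialize (Hd (RtoC t * y) (fun P HP => HP) eps). apply near_iff in Hd.
    destruct Hd as [d [Hd0 Hd]].
    exists (mkposreal d Hd0). intros s Hs.
    assert (Hs' : (Rabs (s - t) < d)%R) by exact Hs.
    assert (Es : RtoC s * y - RtoC t * y = RtoC (s - t) * y) by (rewrite RtoC_minus; ring).
    assert (Em : (Cmod (RtoC s * y - RtoC t * y) <= Rabs (s - t))%R).
    { rewrite Es, Cmod_mult, Cmod_R.
      assert (H := Cmod_ge_0 y). assert (H1 := Rabs_pos (s - t)). nra. }
    assert (HH : (Cmod (F (RtoC s * y)%C - F (RtoC t * y)%C - (RtoC s * y - RtoC t * y) * 0)
                 <= eps * Cmod (RtoC s * y - RtoC t * y))%R).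
    { apply Hd. lra. }
    assert (G : (Cmod (F (RtoC s * y)%C - F (RtoC t * y)%C) <= eps * Rabs (s - t))%R).
    { replace (F (RtoC s * y)%C - F (RtoC t * y)%C) with
        (F (RtoC s * y)%C - F (RtoC t * y)%C - (RtoC s * y - RtoC t * y) * 0) by ring.
      assert (H := cond_pos eps). nra. }
    rewrite Cmod_norm in G.
    refine (eq_ind _ (fun v : C_R_NormedModule => (norm v <= eps * norm (minus s t))%R) G _ _).
    rewrite (scal_zero_r (V := C_R_NormedModule)).
    symmetry. exact (minus_zero_r (G := C_R_NormedModule) _). }
  rewrite Cmult_0_l, Cmult_1_l in E. now symmetry.
Qed.

(** The difference quotient of w^(j+1), namely the sum of w^i z^(j-i) for i <= j. *)
Fixpoint chord (w z : C) (j : nat) : C :=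
  match j with
  | O => 1
  | S i => w * chord w z i + z ^ S i
  end.

Lemma chord_spec (w z : C) (j : nat) : (w - z) * chord w z j = w ^ S j - z ^ S j.
Proof.
  induction j as [|j IH].
  - simpl. ring.
  - replace (w ^ S (S j) - z ^ S (S j)) with
      (w * (w ^ S j - z ^ S j) + (w - z) * z ^ S j) by (simpl; ring).
    rewrite <- IH. simpl. ring.
Qed.

Lemma Cmod_chord_le (w z : C) (p : R) (j : nat) :
  (Cmod w <= p)%R -> (Cmod z <= p)%R -> (Cmod (chord w z j) <= INR (S j) * p ^ j)%R.
Proof.
  intros Hw Hz. induction j as [|j IH].
  - simpl. rewrite Cmod_1. lra.
  - rewrite S_INR.
    assert (Hz' : (Cmod (z ^ S j) <= p ^ S j)%R).
    { rewrite Cmod_pow. apply pow_incr. split; [apply Cmod_ge_0 | easy]. }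
    change (chord w z (S j)) with (w * chord w z j + z ^ S j).
    apply Rle_trans with (1 := Cmod_triangle _ _). rewrite Cmod_mult.
    assert (H : (Cmod w * Cmod (chord w z j) <= p * (INR (S j) * p ^ j))%R).
    { apply Rmult_le_compat; auto using Cmod_ge_0. }
    simpl in *. lra.
Qed.

Lemma Clim_id (z : C) : Clim (near z) (fun w => w) z.
Proof.
  apply Clim_iff; [apply filter_C|]. intros eps He.
  apply near_iff. now exists eps.
Qed.

Lemma Clim_chord (z : C) (j : nat) :
  Clim (near z) (fun w => chord w z j) (RtoC (INR (S j)) * z ^ j).
Proof.
  induction j as [|j IH].
  - simpl. rewrite Cmult_1_r. apply Clim_const, filter_C.
  - replace (RtoC (INR (S (S j))) * z ^ S j) with
      (z * (RtoC (INR (S j)) * z ^ j) + z ^ S j)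
      by (rewrite (S_INR (S j)), RtoC_plus; simpl; ring).
    apply Clim_plus; [apply filter_C | | apply Clim_const, filter_C].
    apply Clim_mult; [apply filter_C | apply Clim_id | exact IH].
Qed.

Lemma INR_S_neq_0 (j : nat) : RtoC (INR (S j)) <> 0.
Proof. intros H. apply RtoC_inj in H. now apply not_0_INR in H. Qed.

Lemma Cmod_INR_S (j : nat) : Cmod (RtoC (INR (S j))) = INR (S j).
Proof. rewrite Cmod_R. apply Rabs_pos_eq, pos_INR. Qed.

Lemma ex_series_geom_scal (M p : R) :
  (0 <= p < 1)%R -> ex_series (fun j => M * p ^ j)%R.
Proof.
  intros Hp. apply (ex_series_scal_l M (fun j => p ^ j)%R).
  apply ex_series_geom. now rewrite Rabs_pos_eq.
Qed.

(** The primitive of sum_j c_j w^j that vanishes at 0. Starting from the coefficients of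
    the derivative, one bound on the c_j suffices for convergence and differentiability on
    the whole unit disc. *)
Definition int_pseries (c : nat -> C) (w : C) : C :=
  CSeries (fun j => c j * w ^ S j / RtoC (INR (S j))).

Lemma Cmod_int_term_le (c : nat -> C) (M p : R) (w : C) (j : nat) :
  (forall i, (Cmod (c i) <= M)%R) -> (Cmod w <= p <= 1)%R ->
  (Cmod (c j * w ^ S j / RtoC (INR (S j))) <= M * p ^ j)%R.
Proof.
  intros Hc Hw. unfold Cdiv.
  rewrite 2!Cmod_mult, Cmod_inv, Cmod_INR_S, Cmod_pow by apply INR_S_neq_0.
  assert (H0 := Cmod_ge_0 w).
  rewrite Rmult_assoc. apply Rmult_le_compat; [apply Cmod_ge_0 | | easy |].
  - apply Rmult_le_pos; [now apply pow_le |].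
    apply Rlt_le, Rinv_0_lt_compat, lt_0_INR. lia.
  - rewrite <- (Rmult_1_r (p ^ j)). apply Rmult_le_compat.
    + now apply pow_le.
    + apply Rlt_le, Rinv_0_lt_compat, lt_0_INR. lia.
    + simpl. apply Rle_trans with (1 * p ^ j)%R; [|lra].
      apply Rmult_le_compat; [easy | now apply pow_le | lra | apply pow_incr; lra].
    + rewrite <- Rinv_1. apply Rinv_le_contravar; [lra|].
      rewrite S_INR. assert (H := pos_INR j). lra.
Qed.

Lemma Csum_int_pseries (c : nat -> C) (M : R) (w : C) :
  (forall i, (Cmod (c i) <= M)%R) -> (Cmod w < 1)%R ->
  Csum (fun j => c j * w ^ S j / RtoC (INR (S j))) (int_pseries c w).
Proof.
  intros Hc Hw. apply Csum_CSeries with (fun j => M * Cmod w ^ j)%R.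
  - intros j. apply Cmod_int_term_le; [easy | lra].
  - apply ex_series_geom_scal. split; [apply Cmod_ge_0 | easy].
Qed.

(** Term-by-term differentiation: on the disc of radius p = (1 + |z|) / 2 the difference
    quotient of the j-th term is at most M p^j, and [tannery] lets w tend to z. *)
Lemma is_derive_int_pseries (c : nat -> C) (M : R) (z : C) :
  (forall i, (Cmod (c i) <= M)%R) -> (Cmod z < 1)%R ->
  Csum (fun j => c j * z ^ j) (CSeries (fun j => c j * z ^ j)) /\
  is_derive (K := C_AbsRing) (V := C_NormedModule) (int_pseries c) z
    (CSeries (fun j => c j * z ^ j)).
Proof.
  intros Hc Hz.
  set (p := ((1 + Cmod z) / 2)%R).
  assert (Hz0 := Cmod_ge_0 z).
  assert (Hp : (0 <= p < 1)%R) by (unfold p; lra).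
  set (a := fun w j => c j / RtoC (INR (S j)) * chord w z j).
  assert (Hloc : near z (fun w => (Cmod w <= p)%R)).
  { apply near_iff. exists ((1 - Cmod z) / 2)%R. split; [lra|].
    intros w Hw. replace w with (z + (w - z)) by ring.
    apply Rle_trans with (1 := Cmod_triangle _ _). unfold p. lra. }
  assert (HM := ex_series_geom_scal M p Hp).
  assert (Ha : forall w, (Cmod w <= p)%R ->
    (forall j, (Cmod (a w j) <= M * p ^ j)%R) /\ Csum (a w) (CSeries (a w))).
  { intros w Hw.
    assert (Hj : forall j, (Cmod (a w j) <= M * p ^ j)%R).
    { intros j. unfold a. unfold Cdiv.
      rewrite 2!Cmod_mult, Cmod_inv, Cmod_INR_S by apply INR_S_neq_0.
      assert (Hn : (0 < INR (S j))%R) by (apply lt_0_INR; lia).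
      rewrite Rmult_assoc. apply Rmult_le_compat; [apply Cmod_ge_0 | | easy |].
      - apply Rmult_le_pos; [now apply Rlt_le, Rinv_0_lt_compat | apply Cmod_ge_0].
      - apply Rmult_le_reg_l with (INR (S j)); [easy|].
        rewrite <- Rmult_assoc, Rinv_r, Rmult_1_l by lra.
        apply Cmod_chord_le; [easy | unfold p; lra]. }
    split; [exact Hj|]. now apply Csum_CSeries with (2 := HM). }
  destruct (tannery (near z) a (fun w => CSeries (a w))
    (fun j => c j * z ^ j) (fun j => M * p ^ j)%R HM) as [H1 H2].
  - generalize Hloc. apply filter_imp. exact Ha.
  - intros j. unfold a.
    replace (c j * z ^ j) with (c j / RtoC (INR (S j)) * (RtoC (INR (S j)) * z ^ j))
      by (field; apply INR_S_neq_0).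
    apply Clim_scal; [apply filter_C | apply Clim_chord].
  - split; [exact H1|].
    apply is_derive_caratheodory with (2 := H2).
    generalize Hloc. apply filter_imp. intros w Hw.
    assert (Ew := Csum_int_pseries c M w Hc ltac:(lra)).
    assert (Ez := Csum_int_pseries c M z Hc Hz).
    assert (Eq := Csum_scal (w - z) _ _ (proj2 (Ha w Hw))).
    apply CSeries_unique in Eq. rewrite <- Eq.
    symmetry. apply CSeries_unique.
    replace (int_pseries c w - int_pseries c z) with
      (int_pseries c w + - (1) * int_pseries c z) by ring.
    apply Csum_ext with (2 := Csum_plus _ _ _ _ Ew (Csum_scal (- (1)) _ _ Ez)).
    intros j. unfold a.
    replace ((w - z) * (c j / RtoC (INR (S j)) * chord w z j)) with
     (c j / RtoC (INR (S j)) * ((w - z) * chord w z j)) by ring.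
    rewrite chord_spec. field. apply INR_S_neq_0.
Qed.

(** * Exponential and logarithm *)

Lemma Cexp_plus (z w : C) : Cexp (z + w) = Cexp z * Cexp w.
Proof.
  unfold Cexp, Cmult; simpl. rewrite exp_plus, cos_plus, sin_plus.
  f_equal; unfold Re, Im; ring.
Qed.

Lemma Cexp_RtoC (t : R) : Cexp (RtoC t) = RtoC (exp t).
Proof. unfold Cexp, RtoC; simpl. rewrite cos_0, sin_0. f_equal; ring. Qed.

Lemma Cexp_0 : Cexp 0 = 1.
Proof. now rewrite Cexp_RtoC, exp_0. Qed.

Lemma Cexp_opp (z : C) : Cexp (- z) * Cexp z = 1.
Proof. rewrite <- Cexp_plus, <- Cexp_0. f_equal. ring. Qed.

Lemma Cexp_neq_0 (z : C) : Cexp z <> 0.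
Proof.
  intros H. assert (E := Cexp_opp z). rewrite H, Cmult_0_r in E.
  apply C1_nz. now symmetry.
Qed.

Lemma derive_at_0 (f : R -> R) (l e : R) :
  derivable_pt_lim f 0 l -> (0 < e)%R ->
  exists d, (0 < d)%R /\
    forall t, (Rabs t < d)%R -> (Rabs (f t - f 0 - l * t) <= e * Rabs t)%R.
Proof.
  intros Hf He. destruct (Hf e He) as [d Hd]. exists d. split; [apply cond_pos|].
  intros t Ht. destruct (Req_dec t 0) as [->|Ht0].
  - rewrite Rmult_0_r, 2!Rminus_diag, Rabs_R0. lra.
  - specialize (Hd t Ht0 Ht). rewrite Rplus_0_l in Hd.
    replace (f t - f 0 - l * t)%R with (((f t - f 0) / t - l) * t)%R by (field; easy).
    rewrite Rabs_mult. apply Rmult_le_compat_r; [apply Rabs_pos | lra].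
Qed.

Lemma Cmod_le_Rabs (z : C) : (Cmod z <= Rabs (Re z) + Rabs (Im z))%R.
Proof.
  replace z with (RtoC (Re z) + Ci * RtoC (Im z)) at 1.
  - apply Rle_trans with (1 := Cmod_triangle _ _).
    rewrite Cmod_mult, Cmod_Ci, 2!Cmod_R. lra.
  - destruct z as [a b]. unfold Cplus, Cmult, Ci, RtoC, Re, Im; simpl. f_equal; ring.
Qed.

(** The two components of exp h - 1 - h are combinations of the first-order remainders of
    the real functions exp, cos and sin at 0. *)
Lemma Cexp_near_0 (e : R) : (0 < e)%R ->
  exists d, (0 < d)%R /\
    forall h, (Cmod h < d)%R -> (Cmod (Cexp h - 1 - h) <= e * Cmod h)%R.
Proof.
  intros He.
  (* Each component is at most 4 k |h| when |h| <= k / 2 and k <= 1, as exp <= 3 there. *)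
  set (k := Rmin 1 (e / 8)).
  assert (Hk : (0 < k)%R) by (apply Rmin_pos; lra).
  assert (Hk1 : (k <= 1)%R) by apply Rmin_l.
  assert (Hk2 : (k <= e / 8)%R) by apply Rmin_r.
  destruct (derive_at_0 exp 1 k) as [d1 [Hd1 H1]]; [|easy|].
  { rewrite <- exp_0. apply derivable_pt_lim_exp. }
  destruct (derive_at_0 cos 0 k) as [d2 [Hd2 H2]]; [|easy|].
  { replace 0%R with (- sin 0)%R at 2 by (rewrite sin_0; ring).
    apply derivable_pt_lim_cos. }
  destruct (derive_at_0 sin 1 k) as [d3 [Hd3 H3]]; [|easy|].
  { rewrite <- cos_0. apply derivable_pt_lim_sin. }
  rewrite exp_0 in H1. rewrite cos_0 in H2. rewrite sin_0 in H3.
  exists (Rmin (k / 2) (Rmin d1 (Rmin d2 d3))).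
  split; [repeat apply Rmin_pos; lra|].
  intros h Hh.
  assert (M1 := Rmin_l (k / 2) (Rmin d1 (Rmin d2 d3))).
  assert (M2 := Rmin_r (k / 2) (Rmin d1 (Rmin d2 d3))).
  assert (M3 := Rmin_l d1 (Rmin d2 d3)). assert (M4 := Rmin_r d1 (Rmin d2 d3)).
  assert (M5 := Rmin_l d2 d3). assert (M6 := Rmin_r d2 d3).
  assert (Hre := re_le_Cmod h).
  assert (Him : (Rabs (Im h) <= Cmod h)%R)
    by (apply Rle_trans with (2 := Rmax_Cmod h); apply Rmax_r).
  set (m := Cmod h) in *.
  destruct h as [a b]. unfold Re, Im in *; simpl in Hre, Him.
  assert (E1 := H1 a ltac:(lra)). assert (E2 := H2 b ltac:(lra)).
  assert (E3 := H3 b ltac:(lra)).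
  apply Rle_trans with (1 := Cmod_le_Rabs _).
  unfold Cexp, Cminus, Cplus, Copp, RtoC, Re, Im; simpl.
  replace (exp a * cos b + - (1) + - a)%R with
    (exp a * (cos b - 1 - 0 * b) + (exp a - 1 - 1 * a))%R by ring.
  replace (exp a * sin b + - 0 + - b)%R with
    (exp a * (sin b - 0 - 1 * b) + (exp a - 1 - 1 * a) * b + a * b)%R by ring.
  assert (P := exp_pos a).
  assert (Q : (exp a <= 3)%R).
  { assert (B : (k * Rabs a <= 1 * 1)%R)
      by (apply Rmult_le_compat; [lra | apply Rabs_pos | lra | lra]).
    apply Rabs_le_between in E1. apply Rabs_le_between in Hre. lra. }
  assert (B0 := Rabs_pos a). assert (B1 := Rabs_pos b).
  assert (T1 := Rabs_triang (exp a * (cos b - 1 - 0 * b)) (exp a - 1 - 1 * a)).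
  assert (T2 := Rabs_triang (exp a * (sin b - 0 - 1 * b) + (exp a - 1 - 1 * a) * b) (a * b)).
  assert (T3 := Rabs_triang (exp a * (sin b - 0 - 1 * b)) ((exp a - 1 - 1 * a) * b)).
  rewrite Rabs_mult, (Rabs_pos_eq (exp a)) in T1 by lra.
  rewrite 2!Rabs_mult, (Rabs_pos_eq (exp a)) in T3 by lra.
  rewrite (Rabs_mult a b) in T2.
  set (u := Rabs (exp a - 1 - 1 * a)) in *.
  set (v := Rabs (cos b - 1 - 0 * b)) in *.
  set (w := Rabs (sin b - 0 - 1 * b)) in *.
  assert (V1 : (exp a * v <= 3 * (k * m))%R).
  { apply Rmult_le_compat; [lra | apply Rabs_pos | easy | nra]. }
  assert (V2 : (exp a * w <= 3 * (k * m))%R).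
  { apply Rmult_le_compat; [lra | apply Rabs_pos | easy | nra]. }
  assert (V3 : (u <= k * m)%R) by nra.
  assert (V4 : (u * Rabs b <= k * m * (1 / 2))%R).
  { apply Rmult_le_compat; [apply Rabs_pos | easy | easy | lra]. }
  assert (V5 : (Rabs a * Rabs b <= m * (k / 2))%R).
  { apply Rmult_le_compat; lra. }
  assert (0 <= m)%R by lra.
  assert (8 * (k * m) <= e * m)%R by nra.
  lra.
Qed.

Lemma is_derive_Cexp (z : C) :
  is_derive (K := C_AbsRing) (V := C_NormedModule) Cexp z (Cexp z).
Proof.
  split; [apply is_linear_scal_l|].
  intros x Hx.
  apply (is_filter_lim_locally_unique (V := AbsRing_NormedModule C_AbsRing)) in Hx. subst x.
  intros eps.
  assert (Hm : (0 < Cmod (Cexp z))%R) by apply Cmod_gt_0, Cexp_neq_0.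
  destruct (Cexp_near_0 (eps / Cmod (Cexp z))) as [d [Hd0 Hd]].
  { apply Rdiv_lt_0_compat; [apply cond_pos | easy]. }
  apply near_iff. exists d. split; [easy|]. intros w Hw.
  change (Cmod (Cexp w - Cexp z - (w - z) * Cexp z) <= eps * Cmod (w - z))%R.
  replace (Cexp w - Cexp z - (w - z) * Cexp z) with
    (Cexp z * (Cexp (w - z) - 1 - (w - z))).
  - rewrite Cmod_mult.
    replace (eps * Cmod (w - z))%R with
      (Cmod (Cexp z) * (eps / Cmod (Cexp z) * Cmod (w - z)))%R by (field; lra).
    apply Rmult_le_compat_l; [lra|]. now apply Hd.
  - replace w with (z + (w - z)) at 3 by ring. rewrite Cexp_plus. ring.
Qed.

Lemma Cexp_Clog (z : C) : z <> 0 -> Cexp (Clog z) = z.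
Proof.
  intros Hz. apply Cmod_gt_0 in Hz.
  destruct z as [a b]. unfold Clog, Cexp, Carg, Re, Im; simpl.
  rewrite exp_ln by easy. set (m := Cmod (a, b)) in *.
  assert (Em : (m * m = a * a + b * b)%R).
  { assert (H := Cmod2_alt (a, b)). unfold Re, Im in H; simpl in H. fold m in H. lra. }
  assert (Ha : (-1 <= a / m <= 1)%R).
  { assert (H := re_le_Cmod (a, b)). unfold Re in H; simpl in H. fold m in H.
    apply Rabs_le_between in H.
    split; apply Rmult_le_reg_r with m; try easy; unfold Rdiv;
      rewrite Rmult_assoc, Rinv_l by lra; lra. }
  assert (Hs : (m * sqrt (1 - Rsqr (a / m)) = Rabs b)%R).
  { rewrite <- (Rabs_pos_eq m) at 1 by lra.
    rewrite <- sqrt_Rsqr_abs, <- sqrt_mult_alt by apply Rle_0_sqr.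
    rewrite <- sqrt_Rsqr_abs. f_equal. unfold Rsqr.
    replace (b * b)%R with (m * m - a * a)%R by lra. field. lra. }
  destruct (Rle_dec 0 b) as [Hb|Hb].
  - rewrite cos_acos, sin_acos, Hs, Rabs_pos_eq by easy. f_equal. field. lra.
  - rewrite cos_neg, sin_neg, cos_acos, sin_acos by easy.
    rewrite Ropp_mult_distr_r_reverse, Hs, Rabs_left by lra. f_equal; [field; lra | ring].
Qed.

Lemma Cexp_INR_mult (n : nat) (z : C) : Cexp (RtoC (INR n) * z) = Cexp z ^ n.
Proof.
  induction n as [|n IH].
  - simpl. now rewrite Cmult_0_l, Cexp_0.
  - rewrite S_INR, RtoC_plus, Cmult_plus_distr_r, Cmult_1_l, Cexp_plus, IH. simpl. ring.
Qed.

Lemma Ccpow_INR (z : C) (n : nat) : z <> 0 -> Ccpow z (RtoC (INR n)) = z ^ n.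
Proof. intros Hz. unfold Ccpow. now rewrite Cexp_INR_mult, Cexp_Clog. Qed.

Lemma Clog_RtoC (t : R) : (0 < t)%R -> Clog (RtoC t) = RtoC (ln t).
Proof.
  intros Ht. unfold Clog, Carg.
  rewrite Cmod_R, Rabs_pos_eq by lra. simpl.
  destruct (Rle_dec 0 0) as [_|H]; [|lra].
  rewrite Rdiv_diag by lra. now rewrite acos_1.
Qed.

Lemma one_minus_neq_0 (y : C) : (Cmod y < 1)%R -> 1 - y <> 0.
Proof.
  intros Hy H. assert (E : y = 1) by (rewrite <- (Cplus_0_l y), <- H; ring).
  rewrite E, Cmod_1 in Hy. lra.
Qed.

(** A shift of the index gives s - 1 = y s for the sum s. *)
Lemma Csum_geom (y : C) : (Cmod y < 1)%R -> Csum (fun j => y ^ j) (/ (1 - y)).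
Proof.
  intros Hy.
  assert (Hs : Csum (fun j => y ^ j) (CSeries (fun j => y ^ j))).
  { apply Csum_CSeries with (fun j => Cmod y ^ j)%R.
    - intros j. rewrite Cmod_pow. lra.
    - apply ex_series_geom. rewrite Rabs_pos_eq; [easy | apply Cmod_ge_0]. }
  set (s := CSeries _) in Hs.
  assert (Hne := one_minus_neq_0 y Hy).
  assert (E : s - 1 = y * s).
  { rewrite <- (CSeries_unique _ _ (Csum_scal y _ _ Hs)). symmetry.
    apply CSeries_unique, (Csum_incr (fun j => y ^ j)).
    now replace (s - 1 + y ^ 0) with s by (simpl; ring). }
  replace (/ (1 - y)) with s; [exact Hs|].
  replace s with ((s - 1 + 1 - y * s) / (1 - y)) by (field; easy).
  rewrite E. field. easy.
Qed.

(** The complex numbers carry two normed module structures with the same norm and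
    different balls. The rules for products and compositions produce derivatives in one of
    them, the limits of this file live in the other. *)
Lemma is_derive_C_AbsRing (f : C -> C) (z l : C) :
  is_derive (K := C_AbsRing) (V := AbsRing_NormedModule C_AbsRing) f z l <->
  is_derive (K := C_AbsRing) (V := C_NormedModule) f z l.
Proof. split; (intros [_ H]; split; [apply is_linear_scal_l | exact H]). Qed.

(** The principal value of - log (1 - y). *)
Definition neg_log (y : C) : C := int_pseries (fun _ => 1) y.

(** The left-hand side has derivative zero on the unit disc, since [neg_log] has derivative
    1 / (1 - y). *)
Lemma Cexp_neg_log (y : C) : (Cmod y < 1)%R -> (1 - y) * Cexp (neg_log y) = 1.
Proof.
  intros Hy.
  replace (RtoC 1) with ((1 - 0) * Cexp (neg_log 0)) at 2.
  - apply (constant_of_is_derive_0 (fun y => (1 - y) * Cexp (neg_log y))); [|exact Hy].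
    intros w Hw.
    destruct (is_derive_int_pseries (fun _ => 1) 1 w) as [Hs Hd]; [|easy|].
    { intros i. rewrite Cmod_1. lra. }
    assert (Hg := Csum_geom w Hw).
    rewrite (CSeries_unique _ (/ (1 - w))) in Hd.
    2: { apply Csum_ext with (2 := Hg). intros j. ring. }
    assert (Hne := one_minus_neq_0 w Hw).
    assert (D1 := is_derive_minus (K := C_AbsRing) (V := AbsRing_NormedModule C_AbsRing)
      (fun _ => RtoC 1) (fun y => y) w zero one (is_derive_const _ _) (is_derive_id _)).
    assert (D2 := is_derive_comp (K := C_AbsRing) (V := C_NormedModule) Cexp neg_log w _ _
      (is_derive_Cexp _) (proj2 (is_derive_C_AbsRing _ _ _) Hd)).
    apply is_derive_C_AbsRing in D2.
    assert (D3 := is_derive_mult (K := C_AbsRing) _ _ w _ _ D1 D2 Cmult_comm).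
    assert (E0 : RtoC 0 = (0 - 1) * Cexp (neg_log w) + (1 - w) * (/ (1 - w) * Cexp (neg_log w)))
      by (field; easy).
    refine (eq_ind_r (is_derive (K := C_AbsRing) (V := C_NormedModule) _ w) _ E0).
    apply is_derive_C_AbsRing. exact D3.
  - unfold neg_log. replace (int_pseries (fun _ => 1) 0) with (RtoC 0).
    + rewrite Cexp_0. ring.
    + symmetry. apply CSeries_unique.
      apply Csum_ext with (fun j => 0 * (0 : C) ^ j).
      * intros j. simpl. field. apply INR_S_neq_0.
      * assert (H := Csum_scal 0 _ _ (Csum_geom 0 ltac:(rewrite Cmod_0; lra))).
        rewrite Cmult_0_l in H. exact H.
Qed.

(** * Zeta values *)

Definition zeta_sum (s N : nat) : R := sum_n (fun k => / INR (S k) ^ s)%R N.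

Lemma inv_INR_S_pow_bounds (s k : nat) : (0 < / INR (S k) ^ s <= 1)%R.
Proof.
  assert (H : (1 <= INR (S k))%R) by (rewrite S_INR; assert (H := pos_INR k); lra).
  assert (H1 := pow_R1_Rle _ s H).
  split; [apply Rinv_0_lt_compat; lra|].
  rewrite <- Rinv_1. apply Rinv_le_contravar; lra.
Qed.

Lemma Cmod_div_INR_S_lt_1 (x : C) (k : nat) :
  (Cmod x < 1)%R -> (Cmod (x / RtoC (INR (S k))) < 1)%R.
Proof.
  intros Hx. rewrite Cmod_div, Cmod_INR_S by apply INR_S_neq_0.
  apply Rle_lt_trans with (Cmod x * 1)%R; [|lra].
  apply Rmult_le_compat_l; [apply Cmod_ge_0|].
  assert (H := inv_INR_S_pow_bounds 1 k). rewrite pow_1 in H. lra.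
Qed.

Lemma zeta_sum_bounds (s N : nat) : (2 <= s)%nat -> (0 <= zeta_sum s N <= 2)%R.
Proof.
  intros Hs.
  (* The terms are compared with the telescoping differences 1 / k - 1 / (k + 1). *)
  assert (H : (0 <= zeta_sum s N <= 2 - / INR (S N))%R).
  { unfold zeta_sum. induction N as [|N IH].
    - rewrite sum_O. assert (H := inv_INR_S_pow_bounds s 0). simpl INR in *. lra.
    - rewrite sum_Sn.
      change (0 <= sum_n (fun k => / INR (S k) ^ s) N + / INR (S (S N)) ^ s
        <= 2 - / INR (S (S N)))%R.
      assert (H := inv_INR_S_pow_bounds s (S N)).
      assert (H0 : (0 < INR (S N))%R) by (apply lt_0_INR; lia).
      assert (H2 : (/ INR (S (S N)) ^ s <= / INR (S N) - / INR (S (S N)))%R).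
      { rewrite (S_INR (S N)). set (u := INR (S N)) in *.
        replace (/ u - / (u + 1))%R with (/ (u * (u + 1)))%R by (field; lra).
        apply Rinv_le_contravar; [nra|].
        apply Rle_trans with ((u + 1) ^ 2)%R; [nra|].
        apply Rle_pow; [lra | easy]. }
      lra. }
  assert (H1 := inv_INR_S_pow_bounds 1 N). rewrite pow_1 in H1. lra.
Qed.

Lemma ex_series_inv_INR_pow (s : nat) :
  (2 <= s)%nat -> ex_series (fun k => / INR (S k) ^ s)%R.
Proof.
  intros Hs.
  destruct (ex_finite_lim_seq_incr (zeta_sum s) 2) as [l Hl].
  - intros N. unfold zeta_sum. rewrite sum_Sn.
    assert (H := inv_INR_S_pow_bounds s (S N)).
    change (sum_n (fun k => / INR (S k) ^ s) N
      <= sum_n (fun k => / INR (S k) ^ s) N + / INR (S (S N)) ^ s)%R. lra.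
  - intros N. now apply zeta_sum_bounds.
  - exists l. exact Hl.
Qed.

(** This bounds the terms of zeta(s, 1 - x) by a constant times those of zeta(s). *)
Lemma Cmod_shift_ge (x : C) (k : nat) :
  (Cmod x < 1)%R -> ((1 - Cmod x) * INR (S k) <= Cmod (RtoC (INR (S k)) - x))%R.
Proof.
  intros Hx.
  assert (H : (Cmod (RtoC (INR (S k))) <= Cmod (RtoC (INR (S k)) - x) + Cmod x)%R).
  { replace (RtoC (INR (S k))) with (RtoC (INR (S k)) - x + x) at 1 by ring.
    apply Cmod_triangle. }
  rewrite Cmod_INR_S in H. rewrite S_INR in *.
  assert (H1 := pos_INR k). assert (H2 := Cmod_ge_0 x). nra.
Qed.

Lemma shift_neq_0 (x : C) (k : nat) : (Cmod x < 1)%R -> RtoC (INR (S k)) - x <> 0.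
Proof.
  intros Hx. apply Cmod_gt_0. apply Rlt_le_trans with (2 := Cmod_shift_ge x k Hx).
  apply Rmult_lt_0_compat; [lra | apply lt_0_INR; lia].
Qed.

Lemma Csum_hurwitz_zeta (x : C) (s : nat) : (Cmod x < 1)%R -> (2 <= s)%nat ->
  Csum (fun k => / (RtoC (INR (S k)) - x) ^ s) (hurwitz_zeta (RtoC (INR s)) (1 - x)).
Proof.
  intros Hx Hs.
  assert (E : forall k, RtoC (INR k) + (1 - x) = RtoC (INR (S k)) - x)
    by (intros k; rewrite S_INR, RtoC_plus; ring).
  unfold hurwitz_zeta.
  apply Csum_ext with (fun k => 1 / Ccpow (INR k + (1 - x)) (RtoC (INR s))).
  { intros k. rewrite E, Ccpow_INR by now apply shift_neq_0.
    unfold Cdiv. now rewrite Cmult_1_l. }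
  apply Csum_CSeries with (fun k => (/ (1 - Cmod x) ^ s) * / INR (S k) ^ s)%R.
  - intros k. assert (Hk := shift_neq_0 x k Hx).
    rewrite E, Ccpow_INR by easy. unfold Cdiv.
    rewrite Cmult_1_l, Cmod_inv, Cmod_pow by now apply Cpow_nz.
    rewrite <- Rinv_mult, <- Rpow_mult_distr.
    assert (Hm := Cmod_shift_ge x k Hx).
    assert (Hp : (0 < (1 - Cmod x) * INR (S k))%R)
      by (apply Rmult_lt_0_compat; [lra | apply lt_0_INR; lia]).
    apply Rinv_le_contravar; [now apply pow_lt | apply pow_incr; lra].
  - apply (ex_series_scal_l (K := R_AbsRing) (V := R_NormedModule) (/ (1 - Cmod x) ^ s)%R
      (fun k => / INR (S k) ^ s)%R). now apply ex_series_inv_INR_pow.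
Qed.

Lemma RtoC_sum_n (a : nat -> R) (N : nat) :
  RtoC (sum_n a N) = sum_n (fun k => RtoC (a k)) N.
Proof.
  induction N as [|N IH].
  - now rewrite 2!sum_O.
  - rewrite 2!sum_Sn, <- IH. apply RtoC_plus.
Qed.

Lemma Clim_zeta_sum (s : nat) : (2 <= s)%nat ->
  Clim eventually (fun N => RtoC (zeta_sum s N)) (riemann_zeta (RtoC (INR s))).
Proof.
  intros Hs. unfold riemann_zeta.
  assert (H := Csum_hurwitz_zeta 0 s ltac:(rewrite Cmod_0; lra) Hs).
  replace (RtoC 1 - RtoC 0) with (RtoC 1) in H by ring.
  apply (Clim_ext eventually) with (2 := H).
  intros N. unfold zeta_sum. rewrite RtoC_sum_n. apply sum_n_ext. intros k.
  rewrite RtoC_inv, RtoC_pow.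
  - f_equal. f_equal. ring.
  - apply pow_nonzero, not_0_INR. lia.
Qed.

(** * Euler's constant *)

Definition gamma_seq (n : nat) : R := (sum_n_m (fun k => / INR k) 1 n - ln (INR n))%R.

(** These inequalities make [gamma_seq] decreasing and bounded below. *)
Lemma ln_S_minus_ln_bounds (n : nat) :
  (/ INR (S (S n)) <= ln (INR (S (S n))) - ln (INR (S n)) <= / INR (S n))%R.
Proof.
  rewrite (S_INR (S n)). assert (Hu : (0 < INR (S n))%R) by (apply lt_0_INR; lia).
  set (u := INR (S n)) in *.
  assert (Hln : forall t, (0 < t)%R -> (ln t <= t - 1)%R).
  { intros t Ht. assert (H := exp_ineq1_le (ln t)). rewrite exp_ln in H; lra. }
  split.
  - assert (H := Hln (u / (u + 1))%R ltac:(apply Rdiv_lt_0_compat; lra)).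
    rewrite ln_div in H by lra.
    replace (u / (u + 1) - 1)%R with (- / (u + 1))%R in H by (field; lra). lra.
  - assert (H := Hln ((u + 1) / u)%R ltac:(apply Rdiv_lt_0_compat; lra)).
    rewrite ln_div in H by lra.
    replace ((u + 1) / u - 1)%R with (/ u)%R in H by (field; lra). lra.
Qed.

Lemma gamma_seq_S (n : nat) :
  gamma_seq (S (S n)) =
  (gamma_seq (S n) + / INR (S (S n)) - (ln (INR (S (S n))) - ln (INR (S n))))%R.
Proof.
  assert (E : sum_n_m (fun k => / INR k)%R 1 (S (S n)) =
    (sum_n_m (fun k => / INR k) 1 (S n) + / INR (S (S n)))%R)
    by (apply (sum_n_Sm (G := R_AbelianMonoid)); lia).
  unfold gamma_seq. rewrite E. ring.
Qed.

Lemma gamma_seq_1 : gamma_seq 1 = 1%R.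
Proof. unfold gamma_seq. rewrite sum_n_n. simpl. rewrite ln_1. lra. Qed.

Lemma gamma_seq_decr (n : nat) : (gamma_seq (S (S n)) <= gamma_seq (S n))%R.
Proof. rewrite gamma_seq_S. assert (H := ln_S_minus_ln_bounds n). lra. Qed.

Lemma gamma_seq_bounds (n : nat) : (0 <= gamma_seq (S n) <= 1)%R.
Proof.
  (* The positive lower bound is the one that the induction preserves. *)
  assert (H : (/ INR (S n) <= gamma_seq (S n) <= 1)%R).
  { induction n as [|n IH].
    - rewrite gamma_seq_1. simpl. lra.
    - assert (H := gamma_seq_decr n). assert (H1 := ln_S_minus_ln_bounds n).
      rewrite gamma_seq_S in *. lra. }
  assert (H1 := inv_INR_S_pow_bounds 1 n). rewrite pow_1 in H1. lra.
Qed.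

Lemma is_lim_seq_gamma : is_lim_seq gamma_seq euler_gamma.
Proof.
  apply is_lim_seq_incr_1.
  destruct (ex_finite_lim_seq_decr (fun n => gamma_seq (S n)) 0) as [l Hl].
  - intros n. apply gamma_seq_decr.
  - intros n. apply gamma_seq_bounds.
  - assert (E : euler_gamma = l).
    { apply (is_lim_seq_incr_1 gamma_seq), is_lim_seq_unique in Hl.
      exact (f_equal real Hl). }
    now rewrite E.
Qed.

(** * The gamma and digamma functions *)

(** The Taylor coefficients in w of the derivative of the logarithm of the N-th term of
    Euler's limit at 1 - w. The zeta sums have N + 1 terms, one for each factor in the
    denominator. For j = 0 the logarithm from N^(1-w) compensates the growth of the
    harmonic sum. *)
Definition log_euler_coef (N j : nat) : R :=
  match j with
  | O => (zeta_sum 1 N - ln (INR N))%R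
  | S _ => zeta_sum (S j) N
  end.

(** The Taylor coefficients of the derivative of log Gamma(1 - w). *)
Definition log_gamma_coef (j : nat) : C :=
  match j with
  | O => RtoC euler_gamma
  | S _ => riemann_zeta (RtoC (INR (S j)))
  end.

Lemma zeta_sum_1 (N : nat) : zeta_sum 1 N = sum_n_m (fun k => / INR k)%R 1 (S N).
Proof.
  unfold zeta_sum. rewrite <- sum_n_m_S. apply sum_n_ext. intros k. now rewrite pow_1.
Qed.

Lemma log_euler_coef_0 (N : nat) :
  log_euler_coef N 0 = (gamma_seq N + / INR (S N))%R.
Proof.
  unfold log_euler_coef, gamma_seq. rewrite zeta_sum_1.
  assert (E : sum_n_m (fun k => / INR k)%R 1 (S N) =
    (sum_n_m (fun k => / INR k) 1 N + / INR (S N))%R)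
    by (apply (sum_n_Sm (G := R_AbelianMonoid)); lia).
  rewrite E. ring.
Qed.

Lemma log_euler_coef_bound (N j : nat) : (Cmod (RtoC (log_euler_coef (S N) j)) <= 2)%R.
Proof.
  rewrite Cmod_R. destruct j as [|j].
  - rewrite log_euler_coef_0. assert (H := gamma_seq_bounds N).
    assert (H1 := inv_INR_S_pow_bounds 1 (S N)). rewrite pow_1 in H1.
    rewrite Rabs_pos_eq; lra.
  - assert (H := zeta_sum_bounds (S (S j)) (S N) ltac:(lia)).
    unfold log_euler_coef. rewrite Rabs_pos_eq; lra.
Qed.

Lemma is_lim_seq_inv_INR : is_lim_seq (fun N => / INR (S N))%R 0.
Proof.
  apply (is_lim_seq_incr_1 (fun N => / INR N)%R).
  replace (Finite 0) with (Rbar_inv p_infty) by easy.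
  apply is_lim_seq_inv; [apply is_lim_seq_INR | easy].
Qed.

Lemma Clim_RtoC (u : nat -> R) (l : R) :
  is_lim_seq u l -> Clim eventually (fun n => RtoC (u n)) (RtoC l).
Proof.
  intros H. apply Clim_iff; [apply eventually_filter|].
  intros eps He. apply is_lim_seq_spec in H.
  generalize (H (mkposreal eps He)). apply filter_imp. intros n Hn.
  rewrite <- RtoC_minus, Cmod_R. exact Hn.
Qed.

Lemma Clim_log_euler_coef (j : nat) :
  Clim eventually (fun N => RtoC (log_euler_coef N j)) (log_gamma_coef j).
Proof.
  destruct j as [|j].
  - apply Clim_RtoC. apply is_lim_seq_ext with (fun N => gamma_seq N + / INR (S N))%R.
    { intros N. now rewrite log_euler_coef_0. }
    replace euler_gamma with (euler_gamma + 0)%R by ring.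
    apply is_lim_seq_plus'; [apply is_lim_seq_gamma | apply is_lim_seq_inv_INR].
  - apply Clim_zeta_sum. lia.
Qed.

Lemma log_gamma_coef_bound (j : nat) : (Cmod (log_gamma_coef j) <= 2)%R.
Proof.
  apply Rnot_lt_le. intros Hlt.
  assert (H := Clim_log_euler_coef j). rewrite Clim_iff in H by apply eventually_filter.
  destruct (H (Cmod (log_gamma_coef j) - 2)%R ltac:(lra)) as [N HN].
  specialize (HN (S N) ltac:(lia)).
  assert (H1 := log_euler_coef_bound N j).
  assert (H2 := Cmod_triangle (RtoC (log_euler_coef (S N) j))
    (- (RtoC (log_euler_coef (S N) j) - log_gamma_coef j))).
  rewrite Cmod_opp in H2.
  replace (RtoC (log_euler_coef (S N) j) + - (RtoC (log_euler_coef (S N) j) - log_gamma_coef j))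
    with (log_gamma_coef j) in H2 by ring.
  lra.
Qed.

(** Each factor is k + 1 - w = (k + 1) (1 - w / (k + 1)). *)
Lemma rising_neg_log (w : C) (N : nat) : (Cmod w < 1)%R ->
  rising (1 - w) (S N) * Cexp (sum_n (fun k => neg_log (w / RtoC (INR (S k)))) N)
  = RtoC (INR (fact (S N))).
Proof.
  intros Hw.
  assert (Hk : forall k, (1 - w + RtoC (INR k)) * Cexp (neg_log (w / RtoC (INR (S k))))
    = RtoC (INR (S k))).
  { intros k. assert (Hn := INR_S_neq_0 k).
    assert (E := Cexp_neg_log _ (Cmod_div_INR_S_lt_1 w k Hw)).
    replace (1 - w + RtoC (INR k)) with
      (RtoC (INR (S k)) * (1 - w / RtoC (INR (S k)))).
    - now rewrite <- Cmult_assoc, E, Cmult_1_r.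
    - replace (RtoC (INR k)) with (RtoC (INR (S k)) - 1)
        by (rewrite S_INR, RtoC_plus; ring).
      field. easy. }
  induction N as [|N IH].
  - rewrite sum_O. change (rising (1 - w) 1) with (1 * (1 - w + RtoC (INR 0))).
    rewrite Cmult_1_l. exact (Hk 0%nat).
  - rewrite sum_Sn.
    change (plus (sum_n (fun k => neg_log (w / RtoC (INR (S k)))) N)
      (neg_log (w / RtoC (INR (S (S N)))))) with
      (sum_n (fun k => neg_log (w / RtoC (INR (S k)))) N + neg_log (w / RtoC (INR (S (S N))))).
    rewrite Cexp_plus.
    change (rising (1 - w) (S (S N))) with (rising (1 - w) (S N) * (1 - w + RtoC (INR (S N)))).
    rewrite fact_simpl, mult_INR, RtoC_mult.
    transitivity ((1 - w + RtoC (INR (S N))) * Cexp (neg_log (w / RtoC (INR (S (S N))))) *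
      (rising (1 - w) (S N) * Cexp (sum_n (fun k => neg_log (w / RtoC (INR (S k)))) N))).
    + ring.
    + now rewrite Hk, IH.
Qed.

Lemma Csum_single (v : C) : Csum (fun j => match j with O => v | S _ => 0 end) v.
Proof.
  apply Csum_decr.
  apply (Clim_ext eventually) with (fun _ => RtoC 0).
  - intros N. symmetry. induction N as [|N IH].
    + now rewrite sum_O.
    + rewrite sum_Sn, IH. apply Cplus_0_r.
  - replace (v - v) with (RtoC 0) by ring. apply Clim_const, eventually_filter.
Qed.

(** Adding the N + 1 logarithms of [rising_neg_log] coefficient by coefficient produces
    the partial zeta sums; the factor N^(-w) contributes to the coefficient of w only. *)
Lemma int_pseries_log_euler_coef (w : C) (N : nat) : (Cmod w < 1)%R ->
  Csum (fun j => RtoC (log_euler_coef N j) * w ^ S j / RtoC (INR (S j)))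
  (sum_n (fun k => neg_log (w / RtoC (INR (S k)))) N - w * RtoC (ln (INR N))).
Proof.
  intros Hw.
  assert (Hk : forall k, (0 <= k <= N)%nat ->
    Csum (fun j => 1 * (w / RtoC (INR (S k))) ^ S j / RtoC (INR (S j)))
      (neg_log (w / RtoC (INR (S k))))).
  { intros k _. apply Csum_int_pseries with 1%R.
    - intros _. rewrite Cmod_1. lra.
    - now apply Cmod_div_INR_S_lt_1. }
  assert (H1 := Csum_sum_n_m _ _ 0 N Hk).
  assert (H2 := Csum_plus _ _ _ _ H1 (Csum_single (- (w * RtoC (ln (INR N)))))).
  apply Csum_ext with (2 := H2). intros j. cbv beta.
  assert (E : sum_n_m (fun k => 1 * (w / RtoC (INR (S k))) ^ S j / RtoC (INR (S j))) 0 N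
    = RtoC (zeta_sum (S j) N) * w ^ S j / RtoC (INR (S j))).
  { unfold zeta_sum. rewrite RtoC_sum_n. unfold Cdiv.
    rewrite <- Cmult_assoc, Cmult_comm.
    rewrite <- (sum_n_mult_l (K := C_Ring)). apply sum_n_m_ext. intros k.
    rewrite RtoC_inv by (apply pow_nonzero, not_0_INR; lia).
    rewrite RtoC_pow, Cpow_mult_l, Cpow_inv by apply INR_S_neq_0.
    unfold mult; simpl. ring. }
  rewrite E. unfold log_euler_coef. destruct j as [|j].
  - rewrite RtoC_minus, Cpow_1_r. change (INR 1) with 1%R. field.
  - ring.
Qed.

(** The factor 1 - 1 / (N + 1) = N / (N + 1) collects the N of N^(1-w) and the last factor
    of (N + 1)!, the numerator being N! only. *)
Lemma Gamma_seq_eq (w : C) (n : nat) : (Cmod w < 1)%R ->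
  let N := S n in
  RtoC (INR (fact N)) * Ccpow (RtoC (INR N)) (1 - w) / rising (1 - w) (S N) =
  RtoC (1 - / INR (S N)) * Cexp (int_pseries (fun j => RtoC (log_euler_coef N j)) w).
Proof.
  intros Hw N.
  unfold int_pseries. rewrite (CSeries_unique _ _ (int_pseries_log_euler_coef w N Hw)).
  assert (E := rising_neg_log w N Hw).
  rewrite fact_simpl, mult_INR, RtoC_mult in E.
  assert (Hu : RtoC (INR (S N)) <> 0) by apply INR_S_neq_0.
  assert (Hf : RtoC (INR (fact N)) <> 0)
    by (intros H; apply RtoC_inj in H; revert H; apply INR_fact_neq_0).
  assert (HN : (0 < INR N)%R) by (apply lt_0_INR; lia).
  assert (EN : RtoC (1 - / INR (S N)) = RtoC (INR N) / RtoC (INR (S N))).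
  { rewrite <- RtoC_div by (apply not_0_INR; lia). f_equal.
    rewrite S_INR. field. lra. }
  rewrite EN. unfold Ccpow. rewrite Clog_RtoC by exact HN.
  set (G := sum_n (fun k => neg_log (w / RtoC (INR (S k)))) N) in *.
  replace ((1 - w) * RtoC (ln (INR N))) with
    (RtoC (ln (INR N)) + (G - w * RtoC (ln (INR N))) + - G) by ring.
  rewrite 2!Cexp_plus, Cexp_RtoC, exp_ln by exact HN.
  assert (EG := Cexp_opp G).
  generalize dependent (rising (1 - w) (S N)). intros A E.
  set (u := RtoC (INR (S N))) in *. set (f := RtoC (INR (fact N))) in *.
  set (X := Cexp (G - w * RtoC (ln (INR N)))). set (n' := RtoC (INR N)).
  set (g := Cexp G) in *. set (g' := Cexp (- G)) in *.
  clearbody u f X n' g g'. clear - E EG Hu Hf.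
  assert (Huf : u * f <> 0) by now apply Cmult_neq_0.
  assert (HA : A <> 0) by (intros H; rewrite H, Cmult_0_l in E; now apply Huf).
  assert (Eg : g' * (u * f) = A)
    by (rewrite <- E; transitivity (g' * g * A); [ring | rewrite EG; ring]).
  assert (Hg : g' <> 0) by (intros H; rewrite H, Cmult_0_l in Eg; now apply HA).
  rewrite <- Eg. field. now repeat split.
Qed.

Lemma Clim_Cexp {T : Type} (F : (T -> Prop) -> Prop) {FF : Filter F} (f : T -> C) (l : C) :
  Clim F f l -> Clim F (fun i => Cexp (f i)) (Cexp l).
Proof.
  intros Hf.
  assert (Hc := ex_derive_continuous (K := C_AbsRing) (V := C_NormedModule) Cexp l
    (ex_intro _ _ (is_derive_Cexp l))).
  intros P HP. exact (Hf _ (proj2 (locally_C _ _) (Hc P HP))).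
Qed.

(** The expansion of log Gamma at 1, in exponential form: the coefficients in
    [Gamma_seq_eq] converge and are bounded by 2, so [tannery] applies. *)
Lemma CGamma_eq (w : C) : (Cmod w < 1)%R ->
  CGamma (1 - w) = Cexp (int_pseries log_gamma_coef w).
Proof.
  intros Hw. apply CLim_seq_unique.
  destruct (tannery eventually
    (fun N j => RtoC (log_euler_coef N j) * w ^ S j / RtoC (INR (S j)))
    (fun N => int_pseries (fun j => RtoC (log_euler_coef N j)) w)
    (fun j => log_gamma_coef j * w ^ S j / RtoC (INR (S j)))
    (fun j => 2 * Cmod w ^ j)%R) as [_ H].
  - apply ex_series_geom_scal. split; [apply Cmod_ge_0 | easy].
  - exists 1%nat. intros [|N] HN; [lia|].
    assert (Hb : forall i, (Cmod (RtoC (log_euler_coef (S N) i)) <= 2)%R)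
      by (intros i; apply log_euler_coef_bound).
    split.
    + intros j. apply (Cmod_int_term_le (fun j => RtoC (log_euler_coef (S N) j))); [easy | lra].
    + now apply (Csum_int_pseries (fun j => RtoC (log_euler_coef (S N) j)) 2).
  - intros j. unfold Cdiv.
    apply (Clim_ext eventually) with
      (fun N => w ^ S j * / RtoC (INR (S j)) * RtoC (log_euler_coef N j)).
    { intros N. ring. }
    replace (log_gamma_coef j * w ^ S j * / RtoC (INR (S j))) with
      (w ^ S j * / RtoC (INR (S j)) * log_gamma_coef j) by ring.
    apply Clim_scal; [apply eventually_filter | apply Clim_log_euler_coef].
  - fold (int_pseries log_gamma_coef w) in H.
    apply (Clim_ext_loc eventually) with (fun N => RtoC (1 - / INR (S N)) *
      Cexp (int_pseries (fun j => RtoC (log_euler_coef N j)) w)).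
    { exists 1%nat. intros [|N] HN; [lia|]. symmetry. now apply Gamma_seq_eq. }
    rewrite <- (Cmult_1_l (Cexp _)).
    apply Clim_mult;
      [apply eventually_filter | | apply Clim_Cexp; [apply eventually_filter | exact H]].
    apply Clim_RtoC. replace 1%R with (1 - 0)%R at 1 by ring.
    apply is_lim_seq_minus'; [apply is_lim_seq_const | apply is_lim_seq_inv_INR].
Qed.

(** The identity [CGamma_eq] holds on a neighbourhood of x, so it may be differentiated. *)
Lemma digamma_eq (x : C) : (Cmod x < 1)%R ->
  digamma (1 - x) = - CSeries (fun j => log_gamma_coef j * x ^ j).
Proof.
  intros Hx.
  destruct (is_derive_int_pseries log_gamma_coef 2 x log_gamma_coef_bound Hx) as [_ Hd].
  set (S1 := CSeries (fun j => log_gamma_coef j * x ^ j)) in *.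
  set (I := int_pseries log_gamma_coef) in *.
  assert (D1 := is_derive_minus (K := C_AbsRing) (V := AbsRing_NormedModule C_AbsRing)
      (fun _ => RtoC 1) (fun y => y) (1 - x) zero one (is_derive_const _ _) (is_derive_id _)).
  apply is_derive_C_AbsRing in Hd.
  replace x with (1 - (1 - x)) in Hd at 1 by ring.
  assert (D2 := is_derive_comp (K := C_AbsRing) (V := AbsRing_NormedModule C_AbsRing)
    I (fun u => 1 - u) (1 - x) _ _ Hd D1).
  assert (D3 := is_derive_comp (K := C_AbsRing) (V := C_NormedModule)
    Cexp (fun u => I (1 - u)) (1 - x) _ _ (is_derive_Cexp _) D2).
  assert (D4 : is_derive (K := C_AbsRing) (V := C_NormedModule) CGamma (1 - x)
    (- S1 * Cexp (I x))).
  { apply is_derive_ext_loc with (fun u => Cexp (I (1 - u))).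
    - apply near_iff. exists (1 - Cmod x)%R. split; [lra|].
      intros u Hu. symmetry. unfold I. rewrite <- CGamma_eq.
      + f_equal. ring.
      + replace (1 - u) with (x + - (u - (1 - x))) by ring.
        apply Rle_lt_trans with (1 := Cmod_triangle _ _). rewrite Cmod_opp. lra.
    - replace (- S1 * Cexp (I x)) with
        ((0 - 1) * S1 * Cexp (I (1 - (1 - x)))).
      + exact D3.
      + replace (1 - (1 - x)) with x by ring. ring. }
  unfold digamma. rewrite (is_C_derive_unique _ _ _ D4), CGamma_eq by easy. fold I.
  field. apply Cexp_neq_0.
Qed.

(** * Binomial sums *)

Lemma binom_n_0 (n : nat) : Binomial.C n 0 = 1%R.
Proof.
  unfold Binomial.C. rewrite Nat.sub_0_r. simpl. field. apply INR_fact_neq_0.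
Qed.

Lemma binom_n_n (n : nat) : Binomial.C n n = 1%R.
Proof.
  unfold Binomial.C. rewrite Nat.sub_diag. simpl. field. apply INR_fact_neq_0.
Qed.

Lemma binomial_theorem (u : C) (r : nat) :
  sum_n (fun m => RtoC (Binomial.C r m) * u ^ m) r = (1 + u) ^ r.
Proof.
  induction r as [|r IH].
  - rewrite sum_O, binom_n_0. simpl. ring.
  - (* Pascal's rule for truncated sums leaves one boundary term. The truncation keeps
       m <= r, beyond which the factorial formula for the coefficients is not zero. *)
    assert (P : forall N, (N <= r)%nat ->
      sum_n (fun m => RtoC (Binomial.C (S r) m) * u ^ m) N =
      (1 + u) * sum_n (fun m => RtoC (Binomial.C r m) * u ^ m) N
        - RtoC (Binomial.C r N) * u ^ S N).
    { induction N as [|N IHN]; intros HN.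
      - rewrite 2!sum_O, 2!binom_n_0. simpl. ring.
      - rewrite 2!sum_Sn, IHN, <- pascal, RtoC_plus by lia.
        set (v := sum_n _ N). unfold plus; simpl. ring. }
    rewrite sum_Sn, P, IH, 2!binom_n_n by lia.
    unfold plus; simpl. ring.
Qed.

(** The coefficient of y^n in the expansion of (1 - y)^-(r+1). *)
Definition neg_binom (r n : nat) : R := Binomial.C (n + r) n.

Lemma neg_binom_r_0 (r : nat) : neg_binom r 0 = 1%R.
Proof. apply binom_n_0. Qed.

Lemma neg_binom_0_n (n : nat) : neg_binom 0 n = 1%R.
Proof. unfold neg_binom. rewrite Nat.add_0_r. apply binom_n_n. Qed.

Lemma neg_binom_S_S (r n : nat) :
  neg_binom (S r) (S n) = (neg_binom (S r) n + neg_binom r (S n))%R.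
Proof.
  unfold neg_binom. replace (S n + r)%nat with (n + S r)%nat by lia.
  rewrite pascal by lia. f_equal.
Qed.

Lemma neg_binom_ge_1 (r n : nat) : (1 <= neg_binom r n)%R.
Proof.
  revert n. induction r as [|r IHr]; intros n.
  - rewrite neg_binom_0_n. lra.
  - induction n as [|n IHn].
    + rewrite neg_binom_r_0. lra.
    + rewrite neg_binom_S_S. assert (H := IHr (S n)). lra.
Qed.

(** By Pascal's rule the partial sums T for r + 1 and U for r satisfy
    T_(N+1) = p T_N + U_(N+1), which bounds T by sup U / (1 - p). *)
Lemma ex_series_neg_binom (r : nat) (p : R) :
  (0 <= p < 1)%R -> ex_series (fun n => neg_binom r n * p ^ n)%R.
Proof.
  intros Hp.
  assert (Hpos : forall r n, (0 <= neg_binom r n * p ^ n)%R).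
  { intros q n. assert (H := neg_binom_ge_1 q n). apply Rmult_le_pos; [lra | now apply pow_le]. }
  induction r as [|r IH].
  - apply ex_series_ext with (fun n => p ^ n)%R.
    + intros n. now rewrite neg_binom_0_n, Rmult_1_l.
    + apply ex_series_geom. now rewrite Rabs_pos_eq.
  - set (T := sum_n (fun n => neg_binom (S r) n * p ^ n)%R).
    set (U := sum_n (fun n => neg_binom r n * p ^ n)%R).
    assert (ES : forall N, (T (S N) = T N + neg_binom (S r) (S N) * p ^ S N)%R)
      by (intros N; unfold T; rewrite sum_Sn; reflexivity).
    assert (EU : forall N, (U (S N) = U N + neg_binom r (S N) * p ^ S N)%R)
      by (intros N; unfold U; rewrite sum_Sn; reflexivity).
    assert (E : forall N, (T (S N) = p * T N + U (S N))%R).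
    { induction N as [|N IHN].
      - rewrite ES, EU, neg_binom_S_S. unfold T, U. rewrite 2!sum_O, 2!neg_binom_r_0. simpl. ring.
      - rewrite ES, EU, (neg_binom_S_S r (S N)), Rmult_plus_distr_r, IHN at 1.
        rewrite (ES N). simpl. ring. }
    destruct (IH : exists L : R, is_lim_seq U L) as [L HL].
    assert (HU : forall N, (U N <= L)%R).
    { apply is_lim_seq_incr_compare; [exact HL|].
      intros N. rewrite EU. assert (H := Hpos r (S N)). lra. }
    destruct (ex_finite_lim_seq_incr T (L / (1 - p))) as [l Hl].
    + intros N. rewrite ES. assert (H := Hpos (S r) (S N)). lra.
    + assert (Hb : forall N, ((1 - p) * T N <= L)%R).
      { intros N.
        assert (H : (T N <= T (S N))%R) by (rewrite ES; assert (H := Hpos (S r) (S N)); lra).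
        rewrite E in H. assert (H' := HU (S N)). lra. }
      intros N. apply Rmult_le_reg_l with (1 - p)%R; [lra|].
      replace ((1 - p) * (L / (1 - p)))%R with L by (field; lra). apply Hb.
    + exists l. exact Hl.
Qed.

(** In the limit the recurrence of [ex_series_neg_binom] reads t = y t + s, where s is the
    sum for r and t the sum for r + 1. *)
Lemma Csum_neg_binom (r : nat) (y : C) : (Cmod y < 1)%R ->
  Csum (fun n => RtoC (neg_binom r n) * y ^ n) ((/ (1 - y)) ^ S r).
Proof.
  intros Hy. assert (Hne := one_minus_neq_0 y Hy).
  induction r as [|r IH].
  - rewrite Cpow_1_r. apply Csum_ext with (2 := Csum_geom y Hy).
    intros n. rewrite neg_binom_0_n. ring.
  - assert (Ht : Csum (fun n => RtoC (neg_binom (S r) n) * y ^ n)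
      (CSeries (fun n => RtoC (neg_binom (S r) n) * y ^ n))).
    { apply Csum_CSeries with (fun n => neg_binom (S r) n * Cmod y ^ n)%R.
      - intros n. assert (H := neg_binom_ge_1 (S r) n).
        rewrite Cmod_mult, Cmod_R, Cmod_pow, Rabs_pos_eq by lra. lra.
      - apply ex_series_neg_binom. split; [apply Cmod_ge_0 | easy]. }
    set (t := CSeries _) in Ht. set (s := (/ (1 - y)) ^ S r) in IH.
    assert (H1 : Csum (fun n => RtoC (neg_binom r (S n)) * y ^ S n) (s - 1)).
    { apply (Csum_incr (fun n => RtoC (neg_binom r n) * y ^ n)).
      rewrite neg_binom_r_0. now replace (s - 1 + RtoC 1 * y ^ 0) with s by (simpl; ring). }
    assert (H2 := Csum_plus _ _ _ _ (Csum_scal y _ _ Ht) H1).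
    assert (H3 : Csum (fun n => RtoC (neg_binom (S r) n) * y ^ n) (y * t + s)).
    { apply Csum_decr. rewrite neg_binom_r_0.
      replace (y * t + s - RtoC 1 * y ^ 0) with (y * t + (s - 1)) by (simpl; ring).
      apply Csum_ext with (2 := H2). intros n. rewrite neg_binom_S_S, RtoC_plus. simpl. ring. }
    assert (E : t = y * t + s).
    { rewrite <- (CSeries_unique _ _ H3). reflexivity. }
    replace ((/ (1 - y)) ^ S (S r)) with t; [exact Ht|].
    rewrite Cpow_S. fold s. replace s with ((1 - y) * t).
    + field. easy.
    + replace s with (t - y * t) by (rewrite E at 1; ring). ring.
Qed.

(** The contribution of one k to both sides of [Csum_neg_binom_zeta]. With n = k + 1 and
    y = x / n, both are (1 / n) ((1 - y)^-(r+1) - (1 - y)^-1): the left one by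
    [Csum_neg_binom], the right one by the binomial theorem for
    n / (n - x) = 1 + x / (n - x). *)
Lemma Csum_hurwitz_term (r k : nat) (x : C) : (Cmod x < 1)%R ->
  Csum (fun j => RtoC (neg_binom r (S j) - 1) * (x ^ S j * / RtoC (INR (S k)) ^ S (S j)))
    (sum_n_m (fun m => RtoC (Binomial.C r m) * x ^ m * / (RtoC (INR (S k)) - x) ^ S m) 1 r).
Proof.
  intros Hx.
  assert (Hy := Cmod_div_INR_S_lt_1 x k Hx).
  assert (Hn := INR_S_neq_0 k). assert (Hs := shift_neq_0 x k Hx).
  set (n := RtoC (INR (S k))) in *. set (y := x / n) in *.
  assert (H1 := Csum_plus _ _ _ _ (Csum_neg_binom r y Hy)
    (Csum_scal (- (1)) _ _ (Csum_geom y Hy))).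
  assert (H2 := Csum_scal (/ n) _ _ H1).
  set (v := / n * _) in H2.
  assert (Ev : v = sum_n_m (fun m =>
    RtoC (Binomial.C r m) * x ^ m * / (n - x) ^ S m) 1 r).
  { assert (E0 : (n - x) * / n = 1 - y) by (unfold y; field; easy).
    assert (Ey : / (1 - y) = n * / (n - x)).
    { rewrite <- E0. field. easy. }
    unfold v. rewrite Ey.
    assert (B : sum_n (fun m => RtoC (Binomial.C r m) * x ^ m * / (n - x) ^ S m) r
      = / (n - x) * (n * / (n - x)) ^ r).
    { replace (n * / (n - x)) with (1 + x * / (n - x)) by (field; easy).
      rewrite <- binomial_theorem, <- (sum_n_mult_l (K := C_Ring)).
      apply sum_n_ext. intros m. unfold mult; simpl.
      rewrite Cpow_mult_l, Cpow_inv by easy. field. split; [now apply Cpow_nz | exact Hs]. }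
    unfold sum_n in B. rewrite sum_Sn_m, binom_n_0 in B by lia.
    unfold plus in B; simpl in B.
    match type of B with _ + ?w = _ => transitivity w; [|reflexivity] end.
    rewrite Cpow_S.
    match type of B with ?c + ?w = ?d => replace w with (d - c) by (rewrite <- B; ring) end.
    field. easy. }
  rewrite <- Ev.
  apply (Csum_incr (fun j => RtoC (neg_binom r j - 1) * (x ^ j * / n ^ S j))).
  rewrite neg_binom_r_0.
  replace (v + _) with v by (rewrite Rminus_diag; ring).
  apply Csum_ext with (2 := H2). intros j.
  rewrite RtoC_minus. unfold y, Cdiv. rewrite Cpow_mult_l, Cpow_inv by easy.
  rewrite Cpow_S. field. split; [now apply Cpow_nz | easy].
Qed.

(** Summing [Csum_hurwitz_term] over k <= N turns the zeta values on the left into their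
    partial sums, which are at most 2; then N tends to infinity by [tannery]. *)
Lemma Csum_neg_binom_zeta (r : nat) (x : C) : (Cmod x < 1)%R ->
  Csum (fun j => RtoC (neg_binom r (S j) - 1) * riemann_zeta (RtoC (INR (S (S j)))) * x ^ S j)
    (sum_n_m (fun m => RtoC (Binomial.C r m) *
      hurwitz_zeta (RtoC (INR (S m))) (1 - x) * x ^ m) 1 r).
Proof.
  intros Hx.
  set (T := fun k => sum_n_m (fun m =>
    RtoC (Binomial.C r m) * x ^ m * / (RtoC (INR (S k)) - x) ^ S m) 1 r).
  set (a := fun N j => RtoC (neg_binom r (S j) - 1) * RtoC (zeta_sum (S (S j)) N) * x ^ S j).
  assert (Ha : forall N, Csum (a N) (sum_n T N)).
  { intros N.
    apply Csum_ext with (2 := Csum_sum_n_m _ T 0 N (fun k _ => Csum_hurwitz_term r k x Hx)).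
    intros j. cbv beta. unfold a, zeta_sum. rewrite RtoC_sum_n.
    rewrite <- Cmult_assoc, (Cmult_comm _ (x ^ S j)), Cmult_assoc.
    rewrite <- (sum_n_mult_l (K := C_Ring)). apply sum_n_m_ext. intros k.
    rewrite RtoC_inv, RtoC_pow by (apply pow_nonzero, not_0_INR; lia).
    unfold mult; simpl. ring. }
  destruct (tannery eventually a (sum_n T)
    (fun j => RtoC (neg_binom r (S j) - 1) * riemann_zeta (RtoC (INR (S (S j)))) * x ^ S j)
    (fun j => 2 * (neg_binom r (S j) * Cmod x ^ S j))%R) as [H1 H2].
  - apply (ex_series_scal_l (K := R_AbsRing) (V := R_NormedModule) 2%R
      (fun j => neg_binom r (S j) * Cmod x ^ S j)%R).
    apply (ex_series_incr_1 (fun j => neg_binom r j * Cmod x ^ j)%R).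
    apply ex_series_neg_binom. split; [apply Cmod_ge_0 | easy].
  - apply filter_forall. intros N. split; [|apply Ha].
    intros j. unfold a. rewrite 2!Cmod_mult, 2!Cmod_R, Cmod_pow.
    assert (Hb := neg_binom_ge_1 r (S j)).
    assert (Hz := zeta_sum_bounds (S (S j)) N ltac:(lia)).
    rewrite 2!Rabs_pos_eq by lra.
    rewrite <- Rmult_assoc, (Rmult_comm 2).
    apply Rmult_le_compat_r; [apply pow_le, Cmod_ge_0|].
    apply Rmult_le_compat; lra.
  - intros j. unfold a.
    apply Clim_mult; [apply eventually_filter | | apply Clim_const, eventually_filter].
    apply Clim_scal; [apply eventually_filter|]. apply Clim_zeta_sum. lia.
  - assert (H3 : Csum T (sum_n_m (fun m => RtoC (Binomial.C r m) *
      hurwitz_zeta (RtoC (INR (S m))) (1 - x) * x ^ m) 1 r)).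
    { apply (Csum_sum_n_m (fun m k =>
        RtoC (Binomial.C r m) * x ^ m * / (RtoC (INR (S k)) - x) ^ S m)).
      intros m Hm.
      replace (RtoC (Binomial.C r m) * hurwitz_zeta (RtoC (INR (S m))) (1 - x) * x ^ m)
        with (RtoC (Binomial.C r m) * x ^ m * hurwitz_zeta (RtoC (INR (S m))) (1 - x)) by ring.
      apply Csum_scal, Csum_hurwitz_zeta; [easy | lia]. }
    assert (E := Clim_unique eventually _ _ _ H2 H3). rewrite <- E. exact H1.
Qed.

(** The case r = 0: [digamma_eq] without its constant term. *)
Lemma Csum_zeta_digamma (x : C) : (Cmod x < 1)%R ->
  Csum (fun j => riemann_zeta (RtoC (INR (S (S j)))) * x ^ S j)
    (- digamma (1 - x) - RtoC euler_gamma).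
Proof.
  intros Hx.
  destruct (is_derive_int_pseries log_gamma_coef 2 x log_gamma_coef_bound Hx) as [Hs _].
  rewrite digamma_eq by easy.
  apply (Csum_incr (fun j => log_gamma_coef j * x ^ j)).
  set (S1 := CSeries _) in *.
  replace (- - S1 - RtoC euler_gamma + log_gamma_coef 0 * x ^ 0) with S1
    by (simpl; ring).
  exact Hs.
Qed.

Theorem proposition23 (r : nat) (x : C) (hx : (Cmod x < 1)%R) :
  is_series (K := C_AbsRing) (V := C_NormedModule)
    (fun k : nat =>
       let n := S k in
       RtoC (Binomial.C (n + r) n) * riemann_zeta (RtoC (INR (n + 1))) * Cpow x n)
    (sum_n_m (fun m : nat =>
       RtoC (Binomial.C r m) * hurwitz_zeta (RtoC (INR (m + 1))) (1 - x) * Cpow x m) 1 r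
     - digamma (1 - x) - RtoC euler_gamma).
Proof.
  assert (H := Csum_plus _ _ _ _ (Csum_neg_binom_zeta r x hx) (Csum_zeta_digamma x hx)).
  set (v := sum_n_m _ 1 r) in H.
  assert (Ev : v = sum_n_m (fun m : nat =>
    RtoC (Binomial.C r m) * hurwitz_zeta (RtoC (INR (m + 1))) (1 - x) * Cpow x m) 1 r)
    by (apply sum_n_m_ext; intros m; now rewrite Nat.add_1_r).
  rewrite <- Ev.
  replace (v - digamma (1 - x) - RtoC euler_gamma) with
    (v + (- digamma (1 - x) - RtoC euler_gamma)) by ring.
  apply Csum_ext with (2 := H).
  intros j. cbv zeta. rewrite (Nat.add_1_r (S j)), RtoC_minus. unfold neg_binom. ring.
Qed.
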